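(* Let $G$ be a finite group such that $G/Z(G)\cong Sz(2)$, where $Sz(2)$ is the Suzuki group presented by $\langle a,b: a^5=b^4=1,\ b^{-1}ab=a^2\rangle$. Let $n=|Z(G)|$. Then \[ M_1(\mathcal{C}(G))=4n(4n-1)^2+15n(3n-1)^2,\qquad M_2(\mathcal{C}(G))=\tfrac12\left[4n(4n-1)^3+15n(3n-1)^3\right], \] \[ M_1(\mathcal{NC}(G))=4740n^3,\qquad M_2(\mathcal{NC}(G))=37440n^4. \] Further, for $\Gamma(G)=\mathcal{C}(G)$ and for $\Gamma(G)=\mathcal{NC}(G)$, \[ \frac{M_2(\Gamma(G))}{|e(\Gamma(G))|}>\frac{M_1(\Gamma(G))}{|v(\Gamma(G))|}. \]
   Context: For a finite simple undirected graph $\Gamma$ with vertex set $v(\Gamma)$ and edge set $e(\Gamma)$, the first and second Zagreb indices are $M_1(\Gamma)=\sum_{v\in v(\Gamma)}\deg(v)^2$ and $M_2(\Gamma)=\sum_{uv\in e(\Gamma)}\deg(u)\deg(v)$. For a finite non-abelian group $G$ with center $Z(G)$, the commuting graph $\mathcal{C}(G)$ is the simple graph with vertex set $G\setminus Z(G)$ in which two distinct vertices $x,y$ are adjacent iff $xy=yx$; the non-commuting graph $\mathcal{NC}(G)$ is the complement of $\mathcal{C}(G)$ (same vertex set, distinct $x,y$ adjacent iff $xy\ne yx$). *)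

(* Defs.v *)
From mathcomp Require Import all_boot all_order all_algebra all_fingroup.
From mathcomp Require Import all_solvable.

Set Implicit Arguments.
Unset Strict Implicit.
Unset Printing Implicit Defensive.

(* The vertex set is a subset of the ambient finite type, not the whole type,
   because the graphs below have vertex set G :\: 'Z(G). *)
Record sgraph (T : finType) := SGraph {
  vertices : {set T};
  adj : rel T;
  adj_vertices : forall x y, adj x y -> (x \in vertices) && (y \in vertices);
  adj_sym : symmetric adj;
  adj_irrefl : irreflexive adj
}.

Section Zagreb.
Variables (T : finType) (Gam : sgraph T).

Definition edges : {set {set T}} :=
  [set [set x; y] | x in vertices Gam, y in vertices Gam & adj Gam x y].

Definition degree (x : T) : nat := #|[set y in vertices Gam | adj Gam x y]|.

Definition zagreb1 : nat := \sum_(x in vertices Gam) degree x ^ 2.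

(* An edge uv is the two-element set [set u; v], so the inner product is
   degree u * degree v. *)
Definition zagreb2 : nat := \sum_(e in edges) \prod_(u in e) degree u.

End Zagreb.

Section Complement.
Variables (T : finType) (Gam : sgraph T).

Definition compl_adj : rel T := fun x y =>
  [&& x \in vertices Gam, y \in vertices Gam, x != y & ~~ adj Gam x y].

Fact compl_adj_vertices x y :
  compl_adj x y -> (x \in vertices Gam) && (y \in vertices Gam).
Proof. by case/and4P=> -> ->. Qed.

Fact compl_adj_sym : symmetric compl_adj.
Proof.
by move=> x y; rewrite /compl_adj (adj_sym Gam x y) (eq_sym x y) andbCA.
Qed.

Fact compl_adj_irrefl : irreflexive compl_adj.
Proof. by move=> x; rewrite /compl_adj eqxx !andbF. Qed.

Definition complement : sgraph T :=
  SGraph compl_adj_vertices compl_adj_sym compl_adj_irrefl.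

End Complement.

Section CommutingGraph.
Local Open Scope group_scope.
Variables (gT : finGroupType) (G : {group gT}).

Definition comm_adj : rel gT := fun x y =>
  [&& x \in G :\: 'Z(G), y \in G :\: 'Z(G), x != y & x * y == y * x].

Fact comm_adj_vertices x y :
  comm_adj x y -> (x \in G :\: 'Z(G)) && (y \in G :\: 'Z(G)).
Proof. by case/and4P=> -> ->. Qed.

Fact comm_adj_sym : symmetric comm_adj.
Proof.
by move=> x y; rewrite /comm_adj (eq_sym x y) (eq_sym (x * y)) andbCA.
Qed.

Fact comm_adj_irrefl : irreflexive comm_adj.
Proof. by move=> x; rewrite /comm_adj eqxx !andbF. Qed.

Definition commuting_graph : sgraph gT :=
  SGraph comm_adj_vertices comm_adj_sym comm_adj_irrefl.

Definition noncommuting_graph : sgraph gT := complement commuting_graph.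

End CommutingGraph.

(* For a presentation of a finite group, MathComp's "_ \isog Grp (_ : _)" says
   "is isomorphic to the presented group"; the one below has order 20. *)
Definition isog_Sz2 (gT : finGroupType) (H : {group gT}) : Prop :=
  (H \isog Grp (a : b : a ^+ 5 = b ^+ 4 = 1, b^-1 * a * b = a ^+ 2))%g.

(* Main.v *)
(* Sz(2) is a Frobenius group A ><| B with |A| = 5 and |B| = 4, so in G / Z(G)
   the centralizer of a nontrivial element is A or a conjugate of B, hence
   cyclic.  Consequently the centralizer in G of a noncentral x is the preimage
   of that cyclic group (which is abelian), of order 5n or 4n.  With S the set
   of the 4n noncentral elements of the preimage of A, the pair formed by S and
   its complement (15n vertices) is then an equitable partition of both graphs,
   and the Zagreb indices can be read off its quotient matrix.  The final
   inequality amounts to 30 n^4 (7n - 2) > 0, resp. 360 n^5 > 0, after clearing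
   denominators. *)
Require Import Defs.
From mathcomp Require Import all_boot all_order all_algebra all_fingroup.
From mathcomp Require Import all_solvable.
From mathcomp Require Import ring lra zify.

Set Implicit Arguments.
Unset Strict Implicit.
Unset Printing Implicit Defensive.

Import Order.TTheory GRing.Theory Num.Theory.

(** * Centralizers in [G] from the Frobenius structure of [G / 'Z(G)] *)

Section Sz2Quotient.
Local Open Scope group_scope.

(* The cyclic group of order 4 is a quotient of Sz(2), via a := 1: this is the
   only lower bound on the order of the presented group that is needed. *)
Lemma isog_Sz2_dvd4 (gT : finGroupType) (H : {group gT}) :
  isog_Sz2 H -> 4 %| #|H|.
Proof.
move=> HSz; have <-: #|[set: 'Z_4]%G| = 4 by rewrite cardsT card_ord.
apply: card_homg; rewrite HSz; apply/existsP.
exists (1, Zp1) => /=; rewrite !xpair_eqE; apply/and4P; split.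
- by rewrite cycle1 joing1G eqEsubset subsetT /= -Zp_cycle; apply/subsetP.
- by rewrite expg1n.
- by [].
by rewrite mulg1 mulVg expg1n.
Qed.

(** Non-cyclicity excludes [a = 1], so [a] has order 5; the bound [4 %| #|H|] then forces [b] to
    have order 4. *)
Lemma isog_Sz2_Frobenius (gT : finGroupType) (H : {group gT}) :
  isog_Sz2 H -> ~~ cyclic H ->
  exists A B : {group gT},
    [/\ [Frobenius H = A ><| B], cyclic A, cyclic B, #|A| = 5 & #|B| = 4].
Proof.
move=> HSz ncycH.
have dvd4H := isog_Sz2_dvd4 HSz.
have/existsP[[a b]] := isoGrp_hom HSz.
rewrite /= !xpair_eqE => /and4P[/eqP genH /eqP a5 /eqP b4 /eqP ab].
have {}ab: a ^ b = a ^+ 2 by rewrite conjgE mulgA.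
have nAB: <[b]> \subset 'N(<[a]>) by rewrite norms_cycle ab mem_cycle.
have oa: #[a] = 5.
  apply: nt_prime_order => //; apply: contraNneq ncycH => a1.
  by rewrite -genH a1 cycle1 joing1G cycle_cyclic.
have defH: <[a]> * <[b]> = H by rewrite -norm_joinEr.
(* As 4 is coprime to 5, it suffices that 4 divides [#[a] * #[b]], a multiple of [#|H|]. *)
have ob: #[b] = 4.
  apply/eqP; rewrite eqn_dvd order_dvdn b4 eqxx -(@Gauss_dvdr 4 5) //.
  by rewrite -oa orderE orderE mul_cardG defH dvdn_mulr.
have tiAB: <[a]> :&: <[b]> = 1 by apply: coprime_TIg; rewrite -!orderE oa ob.
exists <[a]>%G, <[b]>%G; split; rewrite ?cycle_cyclic -?orderE //.
apply/Frobenius_semiregularP.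
- by rewrite sdprodE.
- by rewrite cycle_eq1 -order_gt1 oa.
- by rewrite cycle_eq1 -order_gt1 ob.
have abX k : a ^ (b ^+ k) = a ^+ (2 ^ k).
  by elim: k => [|k IHk]; rewrite ?conjg1 // expgSr conjgM IHk conjXg ab
    -expgM -expnS.
(* A nontrivial fixed point of [y = b ^+ k] in the prime-order group [<[a]>] would make [y]
   centralize [a], so [2 ^ k] is 1 modulo 5; since 2 has order 4 modulo 5 and [k < 4], this gives
   [k = 0]. *)
move=> y /setD1P[nty /cyclePmin[k ltk4 def_y]].
apply: prime_TIg; first by rewrite -orderE oa.
apply: contra nty; rewrite cycle_subG cent1C => /cent1P cya.
have: a ^+ (2 ^ k) == a ^+ 1 by rewrite -abX -def_y conjgE -cya mulKg.
rewrite eq_expg_mod_order oa {}def_y; move: ltk4; rewrite ob.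
by case: k => [|[|[|[|]]]].
Qed.

(** The kernel and the sets of nontrivial elements of the complements cover [H]. The trivial
    intersection property of [B] puts the centralizer inside the conjugate that contains [h], and
    commutativity gives equality. *)
Lemma Frobenius_cent1_nker (gT : finGroupType) (H A B : {group gT}) :
  [Frobenius H = A ><| B] -> abelian B ->
  {in H :\: A, forall h, exists y, 'C_H[h] = B :^ y}.
Proof.
move=> frobH abB h /setDP[Hh nAh].
have [/sdprodP[_ /mulG_sub[sAH sBH] _ _] _ _ _ _] := Frobenius_context frobH.
have [/eqP covH _ _] := and3P (Frobenius_partition frobH).
have /bigcupP[_ /setU1P[-> Ah | /imsetP[y Ay ->]]] :
  h \in cover (gval A |: (B^# :^: A)).
- by rewrite covH.
- by rewrite Ah in nAh.
rewrite mem_conjg => Bh; exists y; have [_ _ tiH] := and3P frobH.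
have eqB: 'C_H[h ^ y^-1] = B.
  apply/eqP; rewrite eqEsubset (cent1_normedTI tiH) //= subsetI sBH.
  by rewrite sub_cent1 (subsetP abB) //; case/setD1P: Bh.
rewrite -[in LHS](conjgKV y h) cent1J -[in LHS](conjGid (subsetP sAH _ Ay)).
by rewrite -conjIg eqB.
Qed.

(** The preimage of a cyclic group is a central extension with cyclic quotient, hence abelian; it
    contains [x], so it centralizes [x]. The other inclusion holds in any quotient. *)
Lemma cent1_cosetpre_center (gT : finGroupType) (G : {group gT}) x :
    x \in G -> cyclic 'C_(G / 'Z(G))[coset 'Z(G) x] ->
  'C_G[x] = coset 'Z(G) @*^-1 'C_(G / 'Z(G))[coset 'Z(G) x].
Proof.
move=> Gx cycC; have [sZG nZG] := andP (center_normal G).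
set C := 'C_(_)[_] in cycC *; set Q := coset _ @*^-1 C.
have sQG: Q \subset G by rewrite sub_cosetpre_quo ?center_normal ?subsetIl.
have abQ: abelian Q.
  apply: (@cyclic_factor_abelian _ 'Z(G)); last by rewrite cosetpreK.
  by rewrite subsetI sub_cosetpre (subset_trans (subsetIr G _)) ?centS.
have Nx := subsetP nZG x Gx.
have Qx: x \in Q by rewrite mem_morphpre // inE mem_quotient ?cent1id.
apply/eqP; rewrite eqEsubset subsetI sQG sub_cent1 (subsetP abQ) // !andbT.
by rewrite -sub_quotient_pre ?subIset ?nZG // quotient_subcent1.
Qed.

Lemma Sz2_cent1 (gT : finGroupType) (G : {group gT}) (n := #|'Z(G)|) :
    isog_Sz2 (G / 'Z(G))%G ->
  exists P : {group gT},
    [/\ 'Z(G) \subset P, P \subset G, #|P| = (5 * n)%N, #|G| = (20 * n)%N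
      & {in P :\: 'Z(G), forall x, 'C_G[x] = P}
        /\ {in G :\: P, forall x, #|'C_G[x]| = (4 * n)%N}].
Proof.
move=> HSz; have nsZG := center_normal G; have [sZG nZG] := andP nsZG.
(* A cyclic central quotient makes [G] abelian, so the quotient would be trivial, against its order
   being divisible by 4. *)
have ncycH: ~~ cyclic (G / 'Z(G)).
  apply/negP=> /cyclic_center_factor_abelian/center_idP cGG.
  by have := isog_Sz2_dvd4 HSz; rewrite /= cGG trivg_quotient cards1.
have [A [B [frobH cycA cycB oA oB]]] := isog_Sz2_Frobenius HSz ncycH.
have [defH ntA _ /proper_sub sAH _] := Frobenius_context frobH.
have card_pre (K : {group coset_of 'Z(G)}) : #|coset 'Z(G) @*^-1 K| = (#|K| * n)%N.
  rewrite -(Lagrange (sub_cosetpre K)) -card_quotient ?subsetIl //.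
  by rewrite cosetpreK mulnC.
exists (coset 'Z(G) @*^-1 A)%G; split.
- exact: sub_cosetpre.
- by rewrite sub_cosetpre_quo.
- by rewrite card_pre oA.
- by rewrite -(Lagrange sZG) -card_quotient // -(sdprod_card defH) oA oB mulnC.
split=> x.
  case/setDP=> /[dup] Px /morphpreP[Nx Ax] nZx.
  have Gx: x \in G.
    by move: x Px {Nx Ax nZx}; apply/subsetP; rewrite sub_cosetpre_quo.
  have cx: 'C_(G / 'Z(G))[coset 'Z(G) x] = A.
    apply/eqP; rewrite eqEsubset (Frobenius_cent1_ker frobH) ?subsetI ?sAH /=.
      by rewrite sub_cent1 (subsetP (cyclic_abelian cycA)).
    by rewrite !inE Ax andbT; apply: contraNneq nZx; exact: coset_idr.
  by rewrite cent1_cosetpre_center ?cx.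
case/setDP=> Gx nPx; have Nx := subsetP nZG x Gx.
have nAx: coset 'Z(G) x \in (G / 'Z(G)) :\: A.
  by rewrite inE mem_quotient // andbT; apply: contra nPx => Ax;
    apply/morphpreP.
have [y cx] := Frobenius_cent1_nker frobH (cyclic_abelian cycB) nAx.
rewrite cent1_cosetpre_center ?cx ?cyclicJ //.
by rewrite (card_pre (B :^ y)%G) cardJg oB.
Qed.

End Sz2Quotient.

(* (S, complement of S) is an equitable partition of Gam with quotient matrix
   ((a, b), (c, d)). *)
Definition equitable (T : finType) (Gam : sgraph T) (S : {set T}) (a b c d : nat) :=
  [/\ S \subset vertices Gam,
      {in S, forall x, #|[set y in S | adj Gam x y]| = a
                    /\ #|[set y in vertices Gam :\: S | adj Gam x y]| = b}
    & {in vertices Gam :\: S, forall x, #|[set y in S | adj Gam x y]| = c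
                    /\ #|[set y in vertices Gam :\: S | adj Gam x y]| = d}].

(** * Edge sums as sums over ordered adjacent pairs *)

Section Edges.
Variables (T : finType) (Gam : sgraph T).
Local Notation V := (vertices Gam).

(** The fibre of [(x, y) |-> [set x; y]] over an edge consists of two pairs, distinct because
    adjacency is irreflexive. *)
Lemma sum_edges (F : {set T} -> nat) :
  ((\sum_(e in edges Gam) F e).*2 =
     \sum_(x in V) \sum_(y in V | adj Gam x y) F [set x; y])%N.
Proof.
rewrite pair_big_dep /=.
rewrite (partition_big (fun p : T * T => [set p.1; p.2]) (mem (edges Gam)))
    /=; last first.
  by case=> x y /= /andP[Vx /andP[Vy xy]]; apply/imset2P; exists x y;
    rewrite ?inE ?Vy.
rewrite -mul2n big_distrr /=; apply: eq_bigr => e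
  /imset2P[x y Vx /setIdP[Vy xy] ->].
rewrite (eq_bigl (mem [set (x, y); (y, x)])) => [|[u v] /=].
  rewrite big_setU1 ?big_set1 /= 1?[[set y; x]]setUC ?addnn ?mul2n // inE.
  by apply: contraTneq xy => -[-> _]; rewrite adj_irrefl.
rewrite !inE !xpair_eqE; apply/idP/orP.
  case/andP=> /and3P[_ _ uv] /eqP euv.
  have: u \in [set x; y] by rewrite -euv set21.
  have: v \in [set x; y] by rewrite -euv set22.
  by do 2![case/set2P=> ?]; subst u v; rewrite ?eqxx; auto;
    rewrite adj_irrefl in uv.
by case=> /andP[/eqP-> /eqP->];
  rewrite Vx Vy ?xy 1?adj_sym ?xy ?eqxx 1?setUC ?eqxx.
Qed.

Lemma card_edges : (#|edges Gam|.*2 = \sum_(x in V) degree Gam x)%N.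
Proof.
rewrite -sum1_card sum_edges; apply: eq_bigr => x _.
by rewrite sum1dep_card /degree.
Qed.

Lemma double_zagreb2 :
  ((zagreb2 Gam).*2 = \sum_(x in V) degree Gam x *
     \sum_(y in V | adj Gam x y) degree Gam y)%N.
Proof.
rewrite /zagreb2 sum_edges; apply: eq_bigr => x _; rewrite big_distrr /=.
apply: eq_bigr => y /andP[_ xy]; rewrite big_setU1 ?big_set1 // inE.
by apply: contraTneq xy => ->; rewrite adj_irrefl.
Qed.

(** * Zagreb indices from a quotient matrix *)

Section Equitable.
Variables (S : {set T}) (a b c d : nat).
Hypothesis eqS : equitable Gam S a b c d.
Local Open Scope nat_scope.

Lemma sum_vertices (P : pred T) (F : T -> nat) :
  \sum_(x in V | P x) F x =
    \sum_(x in S | P x) F x + \sum_(x in V :\: S | P x) F x.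
Proof.
have [sSV _ _] := eqS; rewrite (bigID (mem S)) /=; congr (_ + _).
  apply: eq_bigl => x; rewrite andbAC; case Sx: (x \in S); rewrite ?andbF //=.
  by rewrite (subsetP sSV) ?andbT.
by apply: eq_bigl => x; rewrite inE andbC andbA.
Qed.

Lemma degree_equitable x :
  x \in V -> degree Gam x = if x \in S then a + b else c + d.
Proof.
move=> Vx; have [sSV S1 S2] := eqS.
rewrite /degree -sum1dep_card sum_vertices !sum1dep_card.
case: ifP => Sx; first by have [-> ->] := S1 x Sx.
by have [|-> ->] := S2 x; rewrite // inE Sx.
Qed.

Lemma sum_degree_adj_equitable x : x \in V ->
  \sum_(y in V | adj Gam x y) degree Gam y =
    if x \in S then a * (a + b) + b * (c + d) else c * (a + b) + d * (c + d).
Proof.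
move=> Vx; have [sSV S1 S2] := eqS; rewrite sum_vertices.
rewrite (eq_bigr (fun=> a + b)) => [|y /andP[Sy _]]; last first.
  by rewrite degree_equitable ?Sy ?(subsetP sSV).
rewrite [X in _ + X = _](eq_bigr (fun=> c + d)) ; last first.
  move=> y /andP[/setDP[Vy /negPf nSy] _].
  by rewrite degree_equitable ?nSy.
rewrite !sum_nat_cond_const.
case: ifP => Sx; first by have [-> ->] := S1 x Sx.
by have [|-> ->] := S2 x; rewrite // inE Sx.
Qed.

(** Indexing the two class values by a boolean lets the three counts below be instances of one
    formula. *)
Lemma sum_equitable (F : T -> nat) (f : bool -> nat) :
    {in V, forall x, F x = f (x \in S)} ->
  \sum_(x in V) F x = #|S| * f true + #|V :\: S| * f false.
Proof.
move=> Ff; have [sSV _ _] := eqS.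
rewrite (eq_bigl (fun x => (x \in V) && true)) ; last first.
  by move=> x; rewrite andbT.
rewrite sum_vertices -!sum_nat_const.
congr (_ + _); apply: eq_big => x; rewrite ?andbT // => Sx.
  by rewrite Ff ?Sx ?(subsetP sSV).
by case/setDP: Sx => Vx /negPf nSx; rewrite Ff ?nSx.
Qed.

Lemma zagreb1_equitable :
  zagreb1 Gam = #|S| * (a + b) ^ 2 + #|V :\: S| * (c + d) ^ 2.
Proof.
apply: (sum_equitable (f := fun Sx => (if Sx then a + b else c + d) ^ 2)) => x Vx.
by rewrite degree_equitable.
Qed.

Lemma card_edges_equitable :
  #|edges Gam|.*2 = #|S| * (a + b) + #|V :\: S| * (c + d).
Proof.
rewrite card_edges.
apply: (sum_equitable (f := fun Sx => if Sx then a + b else c + d)) => x Vx.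
exact: degree_equitable.
Qed.

Lemma zagreb2_equitable :
  (zagreb2 Gam).*2 = #|S| * ((a + b) * (a * (a + b) + b * (c + d)))
                   + #|V :\: S| * ((c + d) * (c * (a + b) + d * (c + d))).
Proof.
rewrite double_zagreb2.
apply: (sum_equitable (f := fun Sx => (if Sx then a + b else c + d) *
  (if Sx then a * (a + b) + b * (c + d) else c * (a + b) + d * (c + d)))) => x Vx.
by rewrite degree_equitable // sum_degree_adj_equitable.
Qed.

End Equitable.
End Edges.

(** * Quotient matrices of the two graphs *)

Section CommutingNeighbours.
Local Open Scope group_scope.
Variables (gT : finGroupType) (G : {group gT}).
Let n := #|'Z(G)|.
Local Notation V := (G :\: 'Z(G)).

Lemma mem_cent1E (x y : gT) : (y \in 'C[x]) = (x * y == y * x).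
Proof. by rewrite cent1C; apply/cent1P/eqP. Qed.

Lemma comm_nbrs (A : {set gT}) x : A \subset V -> x \in V ->
  [set y in A | adj (commuting_graph G) x y] = (A :&: 'C_G[x]) :\ x.
Proof.
move=> sAV Vx; apply/setP=> y; rewrite inE in_setD1 !in_setI mem_cent1E.
case Ay: (y \in A); rewrite ?andbF //=.
have Vy := subsetP sAV y Ay; rewrite /comm_adj Vx Vy /=.
by case/setDP: Vy => -> _; rewrite eq_sym.
Qed.

(** Since [x] commutes with itself, removing ['C_G[x]] also accounts for [x != y]. *)
Lemma noncomm_nbrs (A : {set gT}) x : A \subset V -> x \in V ->
  [set y in A | adj (noncommuting_graph G) x y] = A :\: 'C_G[x].
Proof.
move=> sAV Vx; apply/setP=> y; rewrite inE in_setD in_setI mem_cent1E.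
case Ay: (y \in A); rewrite ?andbF //=.
have Vy := subsetP sAV y Ay; have [Gy _] := setDP Vy.
rewrite /compl_adj /= /comm_adj Vx Vy Gy /=.
by case: (eqVneq x y) => [->|] //=; rewrite ?eqxx ?andbT.
Qed.

(** The predecessors come from excluding [x] itself from its centralizer; [12 * n] is
    [15 * n - 3 * n]. *)
Lemma Sz2_equitable :
    isog_Sz2 (G / 'Z(G))%G ->
  exists S : {set gT},
    [/\ #|S| = (4 * n)%N, #|V :\: S| = (15 * n)%N,
        equitable (commuting_graph G) S (4 * n).-1 0 0 (3 * n).-1
      & equitable (noncommuting_graph G) S 0 (15 * n) (4 * n) (12 * n)].
Proof.
move=> HSz; have [P [sZP sPG oP oG [cP cG]]] := Sz2_cent1 HSz.
pose S := P :\: 'Z(G).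
have sSV : S \subset V by apply: setSD.
have sTV : V :\: S \subset V by apply: subsetDl.
have defT : V :\: S = G :\: P.
  apply/setP=> x; rewrite !in_setD negb_and negbK.
  by case Zx: (x \in 'Z(G)); rewrite //= ?(subsetP sZP).
have oS : #|S| = (4 * n)%N by rewrite cardsD (setIidPr sZP) oP -/n; lia.
have oT : #|V :\: S| = (15 * n)%N.
  by rewrite defT cardsD (setIidPr sPG) oP oG -/n; lia.
have n_gt0 : (0 < n)%N := cardG_gt0 _.
have c1 x : x \in S -> #|S :&: 'C_G[x]| = (4 * n)%N
    /\ #|(V :\: S) :&: 'C_G[x]| = 0%N.
  move=> Sx; rewrite cP // defT setIDAC setDIl setDv setI0 cards0 -oS.
  by rewrite (setIidPl (subsetDl _ _)).
have c2 x : x \in V :\: S -> #|S :&: 'C_G[x]| = 0%N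
    /\ #|(V :\: S) :&: 'C_G[x]| = (3 * n)%N.
  move=> Tx; have Px: x \in G :\: P by rewrite -defT.
  (* A noncentral [y] in [P] has centralizer [P], so commuting with it would put [x] in [P]. *)
  have cxP: 'C_G[x] :&: P = 'Z(G).
    case/setDP: (Px) => Gx nPx; apply/setP=> y; apply/setIP/idP=> [[cxy Py] | Zy].
      apply: contraNT nPx => nZy; rewrite -(cP y); last by rewrite in_setD nZy.
      by apply: subcent1C cxy.
    split; last exact: (subsetP sZP).
    by case/setIP: Zy => Gy /centP cy; rewrite in_setI Gy; apply/cent1P/cy.
  split; first by rewrite /S setIDAC [P :&: _]setIC cxP setDv cards0.
  rewrite defT setIDAC (setIidPr (subsetIl _ _)) cardsD cxP cG // -/n; lia.
exists S; split=> //; split=> //= x Ax.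
- have [[oSx oTx] Vx] := (c1 x Ax, subsetP sSV x Ax).
  rewrite !comm_nbrs //; have /setDP[Px nZx] := Ax.
  have Cx: x \in S :&: 'C_G[x] by rewrite in_setI Ax cP.
  have := cardsD1 x (S :&: 'C_G[x]); rewrite Cx oSx => ->.
  by have /eqP := oTx; rewrite cards_eq0 => /eqP->; rewrite set0D cards0.
- have [[oSx oTx] Vx] := (c2 x Ax, subsetP sTV x Ax).
  have Cx: x \in (V :\: S) :&: 'C_G[x].
    by rewrite in_setI Ax in_setI cent1id andbT; case/setDP: Vx.
  rewrite !comm_nbrs //; have := cardsD1 x ((V :\: S) :&: 'C_G[x]).
  rewrite Cx oTx => ->.
  by have /eqP := oSx; rewrite cards_eq0 => /eqP->; rewrite set0D cards0.
- have [[oSx oTx] Vx] := (c1 x Ax, subsetP sSV x Ax).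
  by rewrite !noncomm_nbrs // (cardsD S) (cardsD (V :\: S)) oSx oTx oS oT; lia.
have [[oSx oTx] Vx] := (c2 x Ax, subsetP sTV x Ax).
by rewrite !noncomm_nbrs // (cardsD S) (cardsD (V :\: S)) oSx oTx oS oT; lia.
Qed.

End CommutingNeighbours.

Theorem theorem2p12 (gT : finGroupType) (G : {group gT})
    (hG : isog_Sz2 (G / 'Z(G))%G) :
  let n : rat := (#|('Z(G))%g|%:R)%R in
  let M1 (Gam : sgraph gT) : rat := ((zagreb1 Gam)%:R)%R in
  let M2 (Gam : sgraph gT) : rat := ((zagreb2 Gam)%:R)%R in
  let C := commuting_graph G in
  let NC := noncommuting_graph G in
  [/\ M1 C = (4 * n * (4 * n - 1) ^+ 2 + 15 * n * (3 * n - 1) ^+ 2)%R,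
      M2 C = (1 / 2 * (4 * n * (4 * n - 1) ^+ 3 + 15 * n * (3 * n - 1) ^+ 3))%R,
      M1 NC = (4740 * n ^+ 3)%R,
      M2 NC = (37440%:R * n ^+ 4)%R
    & forall Gam : sgraph gT, Gam = C \/ Gam = NC ->
        (M2 Gam / #|edges Gam|%:R > M1 Gam / #|vertices Gam|%:R)%R].
Proof.
have [S [oS oT eqC eqNC]] := Sz2_equitable hG.
move=> n M1 M2 C NC.
have oV : #|G :\: 'Z(G)%g| = 19 * #|'Z(G)%g|.
  have [sSV _ _] := eqC.
  by have := cardsID S (G :\: 'Z(G)%g); rewrite (setIidPr sSV) oS oT => <-; lia.
have z_gt0 : 0 < #|'Z(G)%g| := cardG_gt0 _.
have n_ge1 : (1 <= n)%R by rewrite ler1n.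
have halve (m k : nat) : m.*2 = k -> (m%:R = k%:R / 2 :> rat)%R.
  by move=> <-; rewrite -muln2 natrM mulfK.
have M1C := congr1 (fun m => m%:R%R : rat) (zagreb1_equitable eqC).
have M1NC := congr1 (fun m => m%:R%R : rat) (zagreb1_equitable eqNC).
have M2C := halve _ _ (zagreb2_equitable eqC).
have M2NC := halve _ _ (zagreb2_equitable eqNC).
have EC := halve _ _ (card_edges_equitable eqC).
have ENC := halve _ _ (card_edges_equitable eqNC).
rewrite /= oS oT in M1C M1NC M2C M2NC EC ENC.
have VC : (#|vertices C|%:R = 19 * n :> rat)%R by rewrite oV natrM.
have VNC : (#|vertices NC|%:R = 19 * n :> rat)%R := VC.
rewrite -/C -/NC in M1C M1NC M2C M2NC EC ENC VC VNC.
rewrite -/(M1 _) -/(M2 _) in M1C M1NC M2C M2NC.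
(* From here on only rational identities in [n] remain; the graphs become opaque. *)
clearbody C NC.
set z := #|'Z(G)%g| in n z_gt0 n_ge1 VC VNC M1C M1NC M2C M2NC EC ENC *.
clearbody z.
(* Positivity of [z] makes the truncated predecessor agree with rational subtraction. *)
have p4 : ((4 * z).-1%:R = 4 * n - 1 :> rat)%R
  by rewrite -subn1 natrB ?natrM // muln_gt0.
have p3 : ((3 * z).-1%:R = 3 * n - 1 :> rat)%R
  by rewrite -subn1 natrB ?natrM // muln_gt0.
rewrite !(add0n, mul0n) ?(natrD, natrM, natrX) -/n in M1NC M2NC ENC.
rewrite !(addn0, add0n, muln0) ?(natrD, natrM, natrX) p4 p3 -/n in M1C M2C EC.
split.
- exact: M1C.
- by rewrite M2C; field.
- by rewrite /M1 M1NC; ring.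
- by rewrite /M2 M2NC; field.
have n_gt0 : (0 < n)%R by apply: lt_le_trans n_ge1.
have cross_lt (m1 m2 v e : rat) :
  (0 < v -> 0 < e -> m1 * e < m2 * v -> m1 / v < m2 / e)%R.
  by move=> v0 e0; rewrite ltr_pdivrMr // mulrAC ltr_pdivlMr.
have v_gt0 : (0 < 19 * n)%R by lra.
have n4_gt0 : (0 < n ^+ 4)%R by apply: exprn_gt0.
have n5_gt0 : (0 < n ^+ 5)%R by apply: exprn_gt0.
move=> Gam [] ->; apply: cross_lt; rewrite ?VC ?VNC.
- exact: v_gt0.
(* The edge count is [(61 n^2 - 19 n) / 2], positive as [n >= 1]. *)
- rewrite EC; nra.
- rewrite EC M1C M2C -subr_gt0.
  rewrite [X in (0 < X)%R](_ : _ = n ^+ 4 * (30 * (7 * n - 2)))%R; last by field.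
  by apply: mulr_gt0; lra.
- exact: v_gt0.
(* Here the edge count is [150 n^2]. *)
- rewrite ENC; nra.
rewrite ENC /M1 M1NC /M2 M2NC -subr_gt0.
rewrite [X in (0 < X)%R](_ : _ = 360 * n ^+ 5)%R; last by field.
by lra.
Qed.
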